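(* Let $L$ be a finite lattice with at least two elements. (i) If $L$ is modular and $H^2$-irreducible, then $\operatorname{length}(\mathrm{Ji}(L))\le 1$. (ii) If $L$ is distributive and $H^2$-irreducible, then $L$ is determined by its weighted double skeleton in the class of all finite distributive lattices; that is, for every finite distributive lattice $L'$ whose weighted double skeleton $S^{\mathrm{wd}}(L')$ is isomorphic to $S^{\mathrm{wd}}(L)$, we have $L'\cong L$. (iii) If $L$ is distributive and $\operatorname{length}(\mathrm{Ji}(L))\le 1$, then $L$ is determined by its weighted double skeleton in the class of finite distributive lattices $D$ satisfying $\operatorname{length}(\mathrm{Ji}(D))\le 1$; that is, for every finite distributive lattice $L'$ with $\operatorname{length}(\mathrm{Ji}(L'))\le 1$ such that $S^{\mathrm{wd}}(L')$ is isomorphic to $S^{\mathrm{wd}}(L)$, we have $L'\cong L$.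
   Context: All lattices are finite; $\prec$ denotes the covering relation. For a finite poset $Q$, $\operatorname{length}(Q)=\max\{n\in\{0,1,2,\dots\}: Q \text{ has an } (n+1)\text{-element chain}\}$. $\mathrm{Ji}(L)$ is the poset of all non-zero join-irreducible elements of $L$, with the order inherited from $L$. Skeleton. A tolerance of $L$ is a reflexive, symmetric relation $R\subseteq L^2$ compatible with join and meet. A block of $R$ is a maximal subset $X\subseteq L$ with $X\times X\subseteq R$; since $L$ is finite, each block $\alpha$ is an interval $[0_\alpha,1_\alpha]$ of $L$. The set $L/R$ of all blocks is a lattice (the factor lattice), where $\alpha\vee\beta$ is the unique block containing $\{x\vee y: x\in\alpha, y\in\beta\}$ and $\alpha\wedge\beta$ is the unique block containing $\{x\wedge y: x\in\alpha,y\in\beta\}$; in it $\alpha\le\beta\iff 0_\alpha\le 0_\beta\iff 1_\alpha\le 1_\beta$. A tolerance of $L$ is glued if its transitive closure is $L^2$ (equivalently, it contains all pairs $(x,y)$ with $x\prec y$). The skeleton tolerance $\Theta(L)$ is the smallest glued tolerance of $L$, and the skeleton of $L$ is the lattice $S(L):=L/\Theta(L)$. Put $S^0(L):=L$ and $S^{i+1}(L):=S(S^i(L))$. $L$ is called $H^n$-irreducible if $|S^n(L)|=1$ (equivalently, the smallest $m$ with $|S^m(L)|=1$, called the Herrmann rank of $L$, is at most $n$). Weighted double skeleton. $S^{\mathrm{wd}}(L)$ is the structure $(P,\le,S(L),\eta_0,\eta_1,\mathsf w)$ where $P=\{0_\alpha:\alpha\in S(L)\}\cup\{1_\alpha:\alpha\in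 S(L)\}$, $\le$ is the order on $P$ inherited from $L$, $\eta_0,\eta_1\colon S(L)\to P$ are given by $\eta_0(\alpha)=0_\alpha$, $\eta_1(\alpha)=1_\alpha$, and for $x\prec y$ in the poset $P$, $\mathsf w(x,y):=\operatorname{length}([x,y]_L)$, the length of the interval $[x,y]$ of $L$. An isomorphism from $(P,\le,K,\eta_0,\eta_1,\mathsf w)$ to $(P',\le',K',\eta_0',\eta_1',\mathsf w')$ is a pair $(\psi,\kappa)$ where $\psi\colon P\to P'$ is an order isomorphism, $\kappa\colon K\to K'$ is a lattice isomorphism, $\psi(\eta_i(x))=\eta_i'(\kappa(x))$ for all $x\in K$, $i\in\{0,1\}$, and $\mathsf w(x,y)=\mathsf w'(\psi(x),\psi(y))$ for all $x\prec y$ in $P$. Two weighted double skeletons are isomorphic if such a pair exists. *)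

(* Defs.v *)
From HB Require Import structures.
From mathcomp Require Import all_boot all_order.
Set Implicit Arguments.
Unset Strict Implicit.
Unset Printing Implicit Defensive.
Import Order.TTheory.
Local Open Scope order_scope.

(* A finite lattice is a [finTBLatticeType]: in mathcomp a [finLatticeType] may
   be empty, and every nonempty finite lattice has a bottom and a top. *)

Definition covers d (Q : porderType d) (x y : Q) : Prop :=
  x < y /\ forall z : Q, ~~ (x < z < y).

Definition is_chain d (Q : finPOrderType d) (C : {set Q}) : bool :=
  [forall x in C, forall y in C, x >=< y].

(* Length of the subposet [A] of [Q]; it is [0] if [A] is empty. *)
Definition poset_length d (Q : finPOrderType d) (A : {set Q}) : nat :=
  \max_(C : {set Q} | is_chain C && (C \subset A)) #|C|.-1.

Definition interval_set d (Q : finPOrderType d) (x y : Q) : {set Q} :=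
  [set z | x <= z <= y].

Definition modular d (L : latticeType d) : Prop :=
  forall x y z : L, x <= z -> x `|` (y `&` z) = (x `|` y) `&` z.

Definition distributive d (L : latticeType d) : Prop :=
  @left_distributive L L Order.meet Order.join.

Definition Ji d (L : finTBLatticeType d) : {set L} :=
  [set x | (x != \bot) &&
           [forall y, forall z, (x == y `|` z) ==> (x == y) || (x == z)]].

Definition is_lattice_iso d d' (L : latticeType d) (L' : latticeType d')
    (f : L -> L') : Prop :=
  [/\ bijective f, {morph f : x y / x `&` y} & {morph f : x y / x `|` y}].

Definition lattice_isomorphic d d' (L : latticeType d) (L' : latticeType d') :=
  exists f : L -> L', is_lattice_iso f.

Definition is_poset_iso d d' (P : porderType d) (P' : porderType d')
    (f : P -> P') : Prop :=
  bijective f /\ {mono f : x y / x <= y}.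

Section Tolerances.
Context {d : Order.disp_t} {L : finTBLatticeType d}.
Implicit Types (x y z a b : L) (R : {set L * L}).

Definition is_tolerance R : bool :=
  [&& [forall x, (x, x) \in R],
      [forall x, forall y, ((x, y) \in R) ==> ((y, x) \in R)],
      [forall p in R, forall q in R, (p.1 `|` q.1, p.2 `|` q.2) \in R] &
      [forall p in R, forall q in R, (p.1 `&` q.1, p.2 `&` q.2) \in R]].

(* [connect] is the reflexive transitive closure, which for a reflexive
   relation is the transitive closure. *)
Definition glued R : bool :=
  [forall x, forall y, connect (fun u v => (u, v) \in R) x y].

Record tolerance := Tolerance {
  tolset :> {set L * L};
  tolerance_subproof : is_tolerance tolset }.

Lemma is_toleranceP R :
  reflect [/\ forall x, (x, x) \in R,
              forall x y, (x, y) \in R -> (y, x) \in R,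
              forall x y z t, (x, y) \in R -> (z, t) \in R ->
                (x `|` z, y `|` t) \in R &
              forall x y z t, (x, y) \in R -> (z, t) \in R ->
                (x `&` z, y `&` t) \in R]
          (is_tolerance R).
Proof.
apply: (iffP and4P) => [[/forallP r /forallP s /forall_inP j /forall_inP m]|
                        [r s j m]].
  split=> [//|x y|x y z t xy zt|x y z t xy zt].
  - by move/forallP: (s x) => /(_ y)/implyP.
  - by have /forall_inP/(_ _ zt) := j _ xy.
  - by have /forall_inP/(_ _ zt) := m _ xy.
split.
- exact/forallP.
- by apply/forallP=> x; apply/forallP=> y; apply/implyP; apply: s.
- by apply/forall_inP=> -[x y] xy; apply/forall_inP=> -[z t] zt; apply: j.
- by apply/forall_inP=> -[x y] xy; apply/forall_inP=> -[z t] zt; apply: m.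
Qed.

Section Factor.
Variable T : tolerance.

Record factor := Block {
  block_set :> {set L};
  block_subproof : maxset (fun X : {set L} => setX X X \subset T) block_set }.

HB.instance Definition _ := [isSub for block_set].
HB.instance Definition _ := [Finite of factor by <:].

Implicit Types alpha beta gamma : factor.

Definition zero_of alpha : L := \meet_(x in alpha) x.
Definition one_of alpha : L := \join_(x in alpha) x.

(* [alpha] is only a dummy default: the block that is picked exists and is
   unique by [factor_joinE] and [factor_meetE] below. *)
Definition factor_join alpha beta : factor :=
  odflt alpha [pick gamma : factor |
    [set x `|` y | x in alpha, y in beta] \subset gamma].
Definition factor_meet alpha beta : factor :=
  odflt alpha [pick gamma : factor |
    [set x `&` y | x in alpha, y in beta] \subset gamma].

Lemma tol_refl x : (x, x) \in (T : {set _}).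
Proof. by case: (is_toleranceP _ (tolerance_subproof T)). Qed.
Lemma tol_sym x y : (x, y) \in (T : {set _}) -> (y, x) \in (T : {set _}).
Proof.
by case: (is_toleranceP _ (tolerance_subproof T)) => _ s _ _; apply: s.
Qed.
Lemma tolU x y z t : (x, y) \in (T : {set _}) -> (z, t) \in (T : {set _}) ->
  (x `|` z, y `|` t) \in (T : {set _}).
Proof.
by case: (is_toleranceP _ (tolerance_subproof T)) => _ _ s _; apply: s.
Qed.
Lemma tolI x y z t : (x, y) \in (T : {set _}) -> (z, t) \in (T : {set _}) ->
  (x `&` z, y `&` t) \in (T : {set _}).
Proof.
by case: (is_toleranceP _ (tolerance_subproof T)) => _ _ _; apply.
Qed.

Lemma clique_ext (X : {set L}) :
  setX X X \subset T -> {alpha : factor | X \subset alpha}.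
Proof.
move=> cX.
have [A mA XA] := @maxset_exists _ (fun X : {set L} => setX X X \subset T) X cX.
by exists (Block mA).
Qed.

Lemma block_tol alpha x y : x \in alpha -> y \in alpha ->
  (x, y) \in (T : {set _}).
Proof.
move=> xa ya; have /maxsetP[/subsetP/(_ (x, y)) + _] := block_subproof alpha.
by rewrite inE /= xa ya; apply.
Qed.

Lemma block_max alpha (X : {set L}) :
  setX X X \subset T -> block_set alpha \subset X -> X = alpha.
Proof. by move=> cX; have /maxsetP[_ m] := block_subproof alpha; apply: m. Qed.

Lemma tol_conv u v x y : (u, v) \in (T : {set _}) ->
  u <= x <= v -> u <= y <= v -> (x, y) \in (T : {set _}).
Proof.
move=> uv /andP[ux xv] /andP[uy yv].
have top z : u <= z -> z <= v -> (z, v) \in (T : {set _}).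
  by move=> uz zv; have := tolU uv (tol_refl z);
    rewrite (join_idPr uz) (join_idPl zv).
have mid z t : u <= z -> z <= v -> u <= t -> t <= v ->
    (z `&` t, t) \in (T : {set _}).
  by move=> uz zv ut tv; have := tolI (top z uz zv) (tol_refl t);
    rewrite (meet_idPr tv).
have xIy := mid x y ux xv uy yv.
have yIx := tol_sym (mid y x uy yv ux xv); rewrite meetC in yIx.
by have := tolU yIx xIy; rewrite meetKU meetUK.
Qed.

Definition tol_ub a := \join_(y | (a, y) \in (T : {set _})) y.
Definition tol_lb a := \meet_(y | (a, y) \in (T : {set _})) y.

Lemma tol_ubP a y : (a, y) \in (T : {set _}) -> y <= tol_ub a.
Proof. by move=> ay; exact: joins_sup. Qed.
Lemma tol_lbP a y : (a, y) \in (T : {set _}) -> tol_lb a <= y.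
Proof. by move=> ay; exact: meets_inf. Qed.

Lemma tol_ubT a : (a, tol_ub a) \in (T : {set _}).
Proof.
have <- : a `|` tol_ub a = tol_ub a.
  exact: (join_idPr (tol_ubP (tol_refl a))).
rewrite /tol_ub; elim/big_ind: _ => [|x y ax ay|x ax].
- by rewrite joinx0 tol_refl.
- by have := tolU ax ay; rewrite joinxx joinACA joinxx.
- by have := tolU (tol_refl a) ax; rewrite joinxx.
Qed.

Lemma tol_lbT a : (a, tol_lb a) \in (T : {set _}).
Proof.
have <- : a `&` tol_lb a = tol_lb a.
  exact: (meet_idPr (tol_lbP (tol_refl a))).
rewrite /tol_lb; elim/big_ind: _ => [|x y ax ay|x ax].
- by rewrite meetx1 tol_refl.
- by have := tolI ax ay; rewrite meetxx meetACA meetxx.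
- by have := tolI (tol_refl a) ax; rewrite meetxx.
Qed.

Lemma tol_lb_le a : tol_lb a <= a. Proof. exact/tol_lbP/tol_refl. Qed.
Lemma tol_ub_le a : a <= tol_ub a. Proof. exact/tol_ubP/tol_refl. Qed.

Lemma tol_lb_mono a b : a <= b -> tol_lb a <= tol_lb b.
Proof.
move=> ab; have := tolI (tol_lbT a) (tol_lbT b); rewrite (meet_idPl ab).
by move/tol_lbP => h; apply: le_trans h (leIr _ _).
Qed.

Lemma tol_ub_mono a b : a <= b -> tol_ub a <= tol_ub b.
Proof.
move=> ab; have := tolU (tol_ubT a) (tol_ubT b); rewrite (join_idPr ab).
by move/tol_ubP => h; apply: le_trans (leUl _ _) h.
Qed.

Lemma zero_le alpha x : x \in alpha -> zero_of alpha <= x.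
Proof. by move=> xa; exact: meets_inf. Qed.
Lemma le_one alpha x : x \in alpha -> x <= one_of alpha.
Proof. by move=> xa; exact: joins_sup. Qed.

Lemma block_neq0 alpha : exists x, x \in alpha.
Proof.
apply/set0Pn/negP=> /eqP a0.
have /(block_max (X := [set \bot])) : setX [set \bot] [set \bot] \subset T.
  by apply/subsetP=> -[x y]; rewrite !inE /= => /andP[/eqP-> /eqP->];
    apply: tol_refl.
move=> /(_ alpha); rewrite a0 sub0set => /(_ isT) /setP/(_ \bot).
by rewrite !inE eqxx.
Qed.

Lemma tol_one alpha x : x \in alpha -> (x, one_of alpha) \in (T : {set _}).
Proof.
move=> xa; have <- : x `|` one_of alpha = one_of alpha.
  exact: (join_idPr (le_one xa)).
rewrite /one_of; elim/big_ind: _ => [|y z xy xz|y ya].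
- by rewrite joinx0 tol_refl.
- by have := tolU xy xz; rewrite joinxx joinACA joinxx.
- by have := tolU (tol_refl x) (block_tol xa ya); rewrite joinxx.
Qed.

Lemma tol_zero_one alpha : (zero_of alpha, one_of alpha) \in (T : {set _}).
Proof.
have [x0 x0a] := block_neq0 alpha.
have <- : zero_of alpha `&` one_of alpha = zero_of alpha.
  exact/meet_idPl/(le_trans (zero_le x0a))/le_one.
rewrite /zero_of; elim/big_ind: _ => [|x y xT yT|x xa].
- by rewrite meet1x tol_refl.
- have -> : (x `&` y) `&` one_of alpha =
            (x `&` one_of alpha) `&` (y `&` one_of alpha).
    by rewrite meetACA meetxx.
  by have := tolI xT yT; rewrite meetxx.
- by rewrite (meet_idPl (le_one xa)); apply: tol_one.
Qed.

(* Every block is an interval. *)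
Lemma in_block alpha x : (x \in alpha) = (zero_of alpha <= x <= one_of alpha).
Proof.
apply/idP/idP => [xa|]; first by rewrite zero_le ?le_one.
suff <- : [set y | zero_of alpha <= y <= one_of alpha] = alpha by rewrite inE.
apply: block_max.
  apply/subsetP=> -[y z]; rewrite !inE => /andP[/= yi zi].
  exact: tol_conv (tol_zero_one alpha) yi zi.
by apply/subsetP=> y ya; rewrite inE zero_le ?le_one.
Qed.

Lemma zero_le_one alpha : zero_of alpha <= one_of alpha.
Proof.
by have [x xa] := block_neq0 alpha; apply: le_trans (zero_le xa) (le_one xa).
Qed.
Lemma zero_in alpha : zero_of alpha \in alpha.
Proof. by rewrite in_block lexx zero_le_one. Qed.
Lemma one_in alpha : one_of alpha \in alpha.
Proof. by rewrite in_block lexx zero_le_one. Qed.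

Lemma block_clique_in alpha x :
  (forall y, y \in alpha -> (x, y) \in (T : {set _})) -> x \in alpha.
Proof.
move=> h; suff <- : x |: alpha = alpha by rewrite setU11.
apply: block_max; last exact: subsetUr.
apply/subsetP=> -[y z]; rewrite !inE /=.
case/andP=> /predU1P[->|ya] /predU1P[->|za].
- exact: tol_refl.
- exact: h.
- exact/tol_sym/h.
- exact: block_tol ya za.
Qed.

Lemma oneE alpha : one_of alpha = tol_ub (zero_of alpha).
Proof.
apply/le_anti; rewrite tol_ubP ?tol_zero_one //=; apply: le_one.
apply: block_clique_in => y ya.
apply: (@tol_conv (zero_of alpha) (tol_ub (zero_of alpha))) => //.
- exact: tol_ubT.
- by rewrite tol_ub_le lexx.
- by rewrite zero_le ?tol_ubP ?(block_tol (zero_in alpha)).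
Qed.

Lemma zeroE alpha : zero_of alpha = tol_lb (one_of alpha).
Proof.
apply/le_anti; rewrite andbC tol_lbP ?(tol_sym (tol_zero_one alpha)) //=.
apply: zero_le; apply: block_clique_in => y ya.
apply: (@tol_conv (tol_lb (one_of alpha)) (one_of alpha)) => //.
- exact/tol_sym/tol_lbT.
- by rewrite tol_lb_le lexx.
- by rewrite le_one ?tol_lbP ?(block_tol (one_in alpha)).
Qed.

Lemma zero_inj : injective zero_of.
Proof.
by move=> a b e; apply/val_inj/setP=> x; rewrite /= !in_block !oneE e.
Qed.

Lemma one_le alpha beta :
  (one_of alpha <= one_of beta) = (zero_of alpha <= zero_of beta).
Proof.
apply/idP/idP => h; first by rewrite !zeroE tol_lb_mono.
by rewrite !oneE tol_ub_mono.
Qed.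

Lemma sub_join_block alpha beta gamma :
  ([set x `|` y | x in alpha, y in beta] \subset gamma) =
  (zero_of gamma == zero_of alpha `|` zero_of beta).
Proof.
apply/subsetP/eqP => [h|e x /imset2P[y z ya zb ->]].
  apply/le_anti; rewrite zero_le ?h ?imset2_f ?zero_in //=.
  have ho : one_of alpha `|` one_of beta <= one_of gamma.
    by apply/le_one/h/imset2_f; apply: one_in.
  rewrite leUx -!one_le; apply/andP; split; apply: le_trans ho.
    exact: leUl.
  exact: leUr.
rewrite in_block e leU2 ?zero_le //=.
rewrite (@le_trans _ _ (one_of alpha `|` one_of beta)) //.
  by rewrite leU2 ?le_one.
by rewrite leUx !one_le e leUl leUr.
Qed.

Lemma sub_meet_block alpha beta gamma :
  ([set x `&` y | x in alpha, y in beta] \subset gamma) =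
  (one_of gamma == one_of alpha `&` one_of beta).
Proof.
apply/subsetP/eqP => [h|e x /imset2P[y z ya zb ->]].
  apply/le_anti; rewrite andbC le_one ?h ?imset2_f ?one_in //=.
  have ho : zero_of gamma <= zero_of alpha `&` zero_of beta.
    by apply/zero_le/h/imset2_f; apply: zero_in.
  rewrite lexI !one_le; apply/andP; split; apply: (le_trans ho).
    exact: leIl.
  exact: leIr.
rewrite in_block e leI2 ?le_one // andbT.
rewrite (@le_trans _ _ (zero_of alpha `&` zero_of beta)) //.
  by rewrite lexI -!one_le e leIl leIr.
by rewrite leI2 ?zero_le.
Qed.

Lemma exists_zero a : {alpha : factor | zero_of alpha = tol_lb a}.
Proof.
have lbU : (tol_lb a, tol_ub (tol_lb a)) \in (T : {set _}) by apply: tol_ubT.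
have [|alpha sub] := @clique_ext [set x | tol_lb a <= x <= tol_ub (tol_lb a)].
  apply/subsetP=> -[y z]; rewrite !inE => /andP[/= yi zi].
  exact: tol_conv lbU yi zi.
exists alpha; apply/le_anti/andP; split.
  by apply/zero_le/(subsetP sub); rewrite inE lexx tol_ub_le.
rewrite zeroE tol_lb_mono // (@le_trans _ _ (tol_ub (tol_lb a))) //.
  by apply/tol_ubP/tol_sym/tol_lbT.
by apply/le_one/(subsetP sub); rewrite inE lexx tol_ub_le.
Qed.

Lemma exists_one a : {alpha : factor | one_of alpha = tol_ub a}.
Proof.
have [alpha e] := exists_zero (tol_ub a); exists alpha.
rewrite oneE e; apply/le_anti/andP; split.
  by apply/tol_ub_mono/tol_lbP/tol_sym/tol_ubT.
by apply/tol_ubP/tol_sym/tol_lbT.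
Qed.

Lemma tol_lbU a b : tol_lb (a `|` b) = tol_lb a `|` tol_lb b.
Proof.
apply/le_anti; rewrite leUx !tol_lb_mono ?leUl ?leUr // !andbT.
by apply: tol_lbP; apply: tolU; apply: tol_lbT.
Qed.

Lemma tol_ubI a b : tol_ub (a `&` b) = tol_ub a `&` tol_ub b.
Proof.
apply/le_anti; rewrite lexI !tol_ub_mono ?leIl ?leIr //=.
by apply: tol_ubP; apply: tolI; apply: tol_ubT.
Qed.

Lemma zero_join alpha beta :
  zero_of (factor_join alpha beta) = zero_of alpha `|` zero_of beta.
Proof.
rewrite /factor_join; case: pickP => [gamma|no] /=.
  by rewrite sub_join_block => /eqP.
have [gamma e] := exists_zero (one_of alpha `|` one_of beta).
by have := no gamma; rewrite sub_join_block e tol_lbU -!zeroE eqxx.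
Qed.

Lemma one_meet alpha beta :
  one_of (factor_meet alpha beta) = one_of alpha `&` one_of beta.
Proof.
rewrite /factor_meet; case: pickP => [gamma|no] /=.
  by rewrite sub_meet_block => /eqP.
have [gamma e] := exists_one (zero_of alpha `&` zero_of beta).
by have := no gamma; rewrite sub_meet_block e tol_ubI -!oneE eqxx.
Qed.

Lemma factor_joinE alpha beta gamma :
  ([set x `|` y | x in alpha, y in beta] \subset gamma) =
  (gamma == factor_join alpha beta).
Proof. by rewrite sub_join_block -zero_join (inj_eq zero_inj). Qed.

Lemma one_inj : injective one_of.
Proof. by move=> a b e; apply: zero_inj; rewrite !zeroE e. Qed.

Lemma factor_meetE alpha beta gamma :
  ([set x `&` y | x in alpha, y in beta] \subset gamma) =
  (gamma == factor_meet alpha beta).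
Proof. by rewrite sub_meet_block -one_meet (inj_eq one_inj). Qed.

Definition factor_le alpha beta : bool := zero_of alpha <= zero_of beta.

Fact factor_le_refl : reflexive factor_le.
Proof. by move=> a; apply: lexx. Qed.
Fact factor_le_anti : antisymmetric factor_le.
Proof. by move=> a b /le_anti/zero_inj. Qed.
Fact factor_le_trans : transitive factor_le.
Proof. by move=> a b c; apply: le_trans. Qed.

HB.instance Definition _ :=
  Order.Le_isPOrder.Build d factor factor_le_refl factor_le_anti factor_le_trans.

Fact factor_meetP alpha beta gamma :
  (alpha <= factor_meet beta gamma) = (alpha <= beta) && (alpha <= gamma).
Proof.
have leE (a b : factor) : (a <= b) = (one_of a <= one_of b) by rewrite one_le.
by rewrite !leE one_meet lexI.
Qed.

Fact factor_joinP alpha beta gamma :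
  (factor_join alpha beta <= gamma) = (alpha <= gamma) && (beta <= gamma).
Proof.
have leE (a b : factor) : (a <= b) = (zero_of a <= zero_of b) by [].
by rewrite !leE zero_join leUx.
Qed.

HB.instance Definition _ :=
  Order.POrder_MeetJoin_isLattice.Build d factor factor_meetP factor_joinP.

Definition factor_bot : factor := sval (exists_zero \bot).
Definition factor_top : factor := sval (exists_one \top).

Fact factor_le0 alpha : factor_bot <= alpha.
Proof.
rewrite /factor_bot; case: exists_zero => beta /= e.
suff : zero_of beta <= zero_of alpha by [].
by rewrite e (le_trans (tol_lb_le _)) ?le0x.
Qed.

Fact factor_le1 alpha : alpha <= factor_top.
Proof.
rewrite /factor_top; case: exists_one => beta /= e.
suff : zero_of alpha <= zero_of beta by [].
by rewrite -one_le e (le_trans _ (tol_ub_le _)) ?lex1.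
Qed.

HB.instance Definition _ := Order.hasBottom.Build d factor factor_le0.
HB.instance Definition _ := Order.hasTop.Build d factor factor_le1.

End Factor.

(* The intersection of all glued tolerances; by [skeleton_tol_smallest] it is
   the smallest one. *)
Definition skeleton_tolset : {set L * L} :=
  \bigcap_(R : {set L * L} | is_tolerance R && glued R) R.

Fact skeleton_tol_subproof : is_tolerance skeleton_tolset.
Proof.
apply/is_toleranceP; split.
- by move=> x; apply/bigcapP=> R /andP[/is_toleranceP[]].
- move=> x y /bigcapP xy; apply/bigcapP=> R gR.
  have /andP[/is_toleranceP[_ s _ _] _] := gR; exact/s/xy.
- move=> x y z t /bigcapP xy /bigcapP zt; apply/bigcapP=> R gR.
  have /andP[/is_toleranceP[_ _ s _] _] := gR; exact: s (xy _ gR) (zt _ gR).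
- move=> x y z t /bigcapP xy /bigcapP zt; apply/bigcapP=> R gR.
  have /andP[/is_toleranceP[_ _ _ s] _] := gR; exact: s (xy _ gR) (zt _ gR).
Qed.

Definition skeleton_tol : tolerance := Tolerance skeleton_tol_subproof.

Lemma glued_covers R x y : is_tolerance R -> glued R -> covers x y ->
  (x, y) \in R.
Proof.
move=> /is_toleranceP[r s j m] /forallP/(_ x)/forallP/(_ y)/connectP[p].
move=> pth yl [xy cxy].
pose f z := (z `|` x) `&` y.
have fxy z : f z = x \/ f z = y.
  have xf : x <= f z by rewrite lexI leUr ltW.
  have fy : f z <= y by rewrite leIr.
  move: xf fy; rewrite !le_eqVlt => /predU1P[e|xf]; first by left.
  by case/predU1P=> [e|fy]; [by right | have := cxy (f z); rewrite xf fy].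
have fT u v : (u, v) \in R -> (f u, f v) \in R.
  by move=> uv; apply: m (r _); apply: j (r _).
have fx : f x = x by rewrite /f joinxx; apply/meet_idPl/ltW.
have fy : f y = y by rewrite /f; apply/meet_idPr/leUl.
have step u : path (fun u v => (u, v) \in R) u p -> f u = x -> f (last u p) = y ->
    (x, y) \in R.
  elim: p {pth yl} u => [|v p IHp] u /=.
    by move=> _ -> e; move: xy; rewrite e ltxx.
  move=> /andP[uv pth] fu l; have [fv|fv] := fxy v; first exact: IHp fv l.
  by rewrite -fu -fv; apply: fT.
by apply: (step x); rewrite -?yl.
Qed.

Lemma covers_glued R : is_tolerance R ->
  (forall x y, covers x y -> (x, y) \in R) -> glued R.
Proof.
move=> /is_toleranceP[r s _ _] cR.
have le_conn x y : x <= y -> connect (fun u v => (u, v) \in R) x y.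
  have [n] := ubnP #|[set z | x <= z <= y]|.
  elim: n x y => // n IHn x y lt_n; rewrite le_eqVlt => /predU1P[->|xy].
    exact: connect0.
  have [z /andP[xz zy]|no] := pickP (fun z => x < z < y); last first.
    apply/connect1/cR; split=> // z; by rewrite no.
  apply: (@connect_trans _ _ z); apply: IHn; rewrite ?ltW //.
    move: lt_n; rewrite ltnS; apply: leq_trans; apply: proper_card.
    apply/properP; split.
      by apply/subsetP=> t; rewrite !inE => /andP[-> /le_trans->]; rewrite ?ltW.
    by exists y; rewrite !inE ?lexx ?(ltW xy) //= (lt_geF zy).
  move: lt_n; rewrite ltnS; apply: leq_trans; apply: proper_card.
  apply/properP; split.
    by apply/subsetP=> t; rewrite !inE => /andP[/(le_trans (ltW xz))-> ->].
  by exists x; rewrite !inE ?lexx ?(ltW xy) //= (lt_geF xz).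
have sym : connect_sym (fun u v => (u, v) \in R).
  by apply: sym_connect_sym => a b; apply/idP/idP; apply: s.
apply/forallP=> x; apply/forallP=> y.
apply: (@connect_trans _ _ \bot); last exact/le_conn/le0x.
by rewrite sym; apply/le_conn/le0x.
Qed.

Lemma skeleton_tol_smallest :
  glued skeleton_tol /\
  forall R, is_tolerance R -> glued R -> (skeleton_tol : {set _}) \subset R.
Proof.
split; last by move=> R tR gR; apply: bigcap_inf; rewrite tR gR.
apply: covers_glued; first exact: tolerance_subproof.
move=> x y cxy; apply/bigcapP=> R /andP[tR gR]; exact: glued_covers cxy.
Qed.

End Tolerances.

Arguments tolerance {d} L.

(* [factor] reuses the display of [L], so that the construction iterates. *)
Definition skeleton d (L : finTBLatticeType d) : finTBLatticeType d :=
  factor (@skeleton_tol d L).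

Definition iter_skeleton d (L : finTBLatticeType d) (n : nat) :
    finTBLatticeType d :=
  iter n (@skeleton d) L.

Definition H_irreducible d (n : nat) (L : finTBLatticeType d) : Prop :=
  #|iter_skeleton L n| = 1%N.

(* The weight is only meaningful on covering pairs, and isomorphisms only
   compare it there. *)
Record weighted_double_poset := WeightedDoublePoset {
  wd_disp : Order.disp_t;
  wd_lat_disp : Order.disp_t;
  wd_poset : finPOrderType wd_disp;
  wd_lat : finTBLatticeType wd_lat_disp;
  wd_eta0 : wd_lat -> wd_poset;
  wd_eta1 : wd_lat -> wd_poset;
  wd_weight : wd_poset -> wd_poset -> nat }.

Definition wd_isomorphic (A B : weighted_double_poset) : Prop :=
  exists (psi : wd_poset A -> wd_poset B) (kappa : wd_lat A -> wd_lat B),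
    [/\ is_poset_iso psi,
        is_lattice_iso kappa,
        forall x, psi (wd_eta0 x) = wd_eta0 (kappa x),
        forall x, psi (wd_eta1 x) = wd_eta1 (kappa x) &
        forall x y, covers x y ->
          wd_weight x y = wd_weight (psi x) (psi y)].

Section WeightedDoubleSkeleton.
Context {d : Order.disp_t}.
Variable L : finTBLatticeType d.

Definition skeleton_ends : {set L} :=
  [set zero_of alpha | alpha : skeleton L] :|:
  [set one_of alpha | alpha : skeleton L].

Record skeleton_end := SkeletonEnd {
  skeleton_end_val :> L;
  skeleton_end_subproof : skeleton_end_val \in skeleton_ends }.

HB.instance Definition _ := [isSub for skeleton_end_val].
HB.instance Definition _ := [Finite of skeleton_end by <:].
HB.instance Definition _ := [SubChoice_isSubPOrder of skeleton_end by <: with d].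

Fact eta0_subproof (alpha : skeleton L) : zero_of alpha \in skeleton_ends.
Proof. by rewrite inE imset_f. Qed.
Fact eta1_subproof (alpha : skeleton L) : one_of alpha \in skeleton_ends.
Proof. by rewrite inE orbC imset_f. Qed.

Definition weighted_double_skeleton : weighted_double_poset :=
  @WeightedDoublePoset d d skeleton_end (skeleton L)
    (fun alpha => SkeletonEnd (eta0_subproof alpha))
    (fun alpha => SkeletonEnd (eta1_subproof alpha))
    (fun x y => poset_length (interval_set (x : L) (y : L))).

End WeightedDoubleSkeleton.

(* Main.v *)
(* On [S(L)], the relation "the two blocks intersect" is a glued tolerance.  If
   [S(S(L))] is trivial it is therefore full, so the top and bottom blocks of
   [L] intersect: [0_top <= 1_bot].  In a modular lattice, the pairs spanning a
   complemented interval form a glued tolerance, so if [q] is join-irreducible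
   and [p < q] then [p] is below every element related to [q].  Hence
   [0_top <= 1_bot] excludes three-element chains of join-irreducibles; for
   distributive [L] the two conditions are equivalent.

   For distributive [L], send a join-irreducible [p] to the pair [(N p, k p)]
   of blocks, where [N p] is the least block whose unit is above [p] and [k p]
   is the greatest block whose zero is not above [p].  Then [p <= q] iff [p = q]
   or not [N q <= k p], so [L] is determined by the skeleton together with the
   number of [p] having each given key.  When [0_top <= 1_bot], the number of
   [p] with [N p <= alpha] and [beta <= k p] is [rank 1_alpha - rank 0_beta],
   where [rank x] counts the join-irreducibles below [x]; these ranks are sums
   of weights along maximal chains of the double skeleton.  Moebius inversion
   over the product of [S(L)] and its dual then recovers the number of [p] with
   each key. *)
Require Import Defs.
From mathcomp Require Import all_boot all_order.
Set Implicit Arguments.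
Unset Strict Implicit.
Unset Printing Implicit Defensive.
Import Order.TTheory.
Local Open Scope order_scope.

(** * Induction and lower covers in finite posets *)

Lemma finposet_ind d (Q : finPOrderType d) (P : Q -> Prop) :
  (forall x, (forall y, y < x -> P y) -> P x) -> forall x, P x.
Proof.
move=> step x; have [n] := ubnP #|[set z | z < x]|.
elim: n x => // n IHn x; rewrite ltnS => le_n; apply: step => y yx; apply: IHn.
apply: leq_trans le_n; apply: proper_card; apply/properP; split.
  by apply/subsetP=> z; rewrite !inE => /lt_trans; apply.
by exists y; rewrite !inE ?yx ?ltxx.
Qed.

Lemma lower_cover d (Q : finPOrderType d) (x y : Q) :
  x < y -> exists2 c, covers c y & x <= c.
Proof.
move=> xy.
have [|m /andP[xm my] maxm] :=
    @arg_maxnP Q x (fun c => x <= c < y) (fun c => #|[set z | z <= c]|).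
  by rewrite lexx.
exists m => //; split=> // z; apply/negP=> /andP[mz zy].
have := maxm z; rewrite (le_trans xm (ltW mz)) zy => /(_ isT).
apply/negP; rewrite -ltnNge; apply: proper_card; apply/properP; split.
  by apply/subsetP=> t; rewrite !inE => /le_trans; apply; apply: ltW.
by exists z; rewrite !inE ?lexx // (lt_geF mz).
Qed.

(** * Join-irreducible elements and rank *)

Section Ji.
Context {d : Order.disp_t} {L : finTBLatticeType d}.
Implicit Types x y z p q r : L.

Lemma Ji_neq0 p : p \in Ji L -> p != \bot.
Proof. by rewrite inE => /andP[]. Qed.

Lemma Ji_join p x y : p \in Ji L -> p = x `|` y -> p = x \/ p = y.
Proof.
rewrite inE => /andP[_ /forallP/(_ x)/forallP/(_ y)/implyP h] e.
by move: h; rewrite {1}e => /(_ (eqxx _))/orP[]/eqP; [left|right].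
Qed.

(** A nonzero element that is not join-irreducible is a join of two smaller elements, to which
    induction applies. *)
Lemma le_Ji x y : (forall p, p \in Ji L -> p <= x -> p <= y) -> x <= y.
Proof.
elim/finposet_ind: x => x IH h.
have [->|x0] := eqVneq x \bot; first exact: le0x.
have [xJ|] := boolP (x \in Ji L); first exact: h.
rewrite inE x0 /= => /forallPn[u /forallPn[v]].
rewrite negb_imply negb_or => /and3P[/eqP e xu xv].
have lu : u <= x by rewrite e leUl.
have lv : v <= x by rewrite e leUr.
rewrite e leUx !IH // ?lt_neqAle 1?eq_sym ?xu ?xv //.
  by move=> p pJ pv; apply: h => //; apply: le_trans lv.
by move=> p pJ pu; apply: h => //; apply: le_trans lu.
Qed.

Lemma eq_Ji x y : (forall p, p \in Ji L -> (p <= x) = (p <= y)) -> x = y.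
Proof.
by move=> h; apply/le_anti/andP; split; apply: le_Ji => p pJ; rewrite h.
Qed.

Lemma length_Ji_le1P :
  reflect (forall p q r, p \in Ji L -> q \in Ji L -> r \in Ji L ->
             p < q -> ~~ (q < r))
          (poset_length (Ji L) <= 1)%N.
Proof.
apply: (iffP idP) => [len p q r pJ qJ rJ pq|no3].
  apply/negP=> qr; have pr := lt_trans pq qr.
  have : (#|[set p; q; r]|.-1 <= poset_length (Ji L))%N.
    apply: (@leq_bigmax_cond _ _ (fun C : {set L} => #|C|.-1)).
    apply/andP; split.
      apply/forall_inP=> x; rewrite !inE -orbA => /or3P[] /eqP->;
      apply/forall_inP=> y; rewrite !inE -orbA => /or3P[] /eqP->;
      by rewrite ?comparablexx // /Order.comparable ?(ltW pq) ?(ltW qr) ?(ltW pr)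
           ?orbT.
    by rewrite !subUset !sub1set pJ qJ rJ.
  rewrite leqNgt in len; apply/negP; apply: contra len => len.
  apply: leq_trans len; rewrite setUC cardsU1 cards2 !inE.
  by rewrite (gt_eqF pr) (gt_eqF qr) (lt_eqF pq).
apply/bigmax_leqP=> C /andP[chC CJ].
have cmp x y : x \in C -> y \in C -> x >=< y.
  by move=> xC yC; move/forall_inP: chC => /(_ x xC)/forall_inP/(_ y yC).
pose low x := [exists y in C, y < x].
have inj : {in C &, injective low}.
  move=> x y xC yC e; have [//|ne] := eqVneq x y.
  wlog xy : x y xC yC e ne / x < y.
    move=> W; have := cmp x y xC yC; rewrite /Order.comparable !le_eqVlt.
    rewrite (eq_sym y) (negbTE ne) /= => /orP[xy|yx]; first exact: W.
    by symmetry; apply: W => //; rewrite eq_sym.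
  have ly : low y by apply/existsP; exists x; rewrite xC.
  move: ly; rewrite -e => /existsP[z /andP[zC zx]].
  have := no3 z x y; rewrite !(subsetP CJ) // => /(_ isT isT isT zx).
  by rewrite xy.
rewrite -subn1 leq_subLR -(card_in_imset inj).
by apply: leq_trans (max_card _) _; rewrite card_bool.
Qed.

Definition Ji_rank x : nat := #|[set p in Ji L | p <= x]|.

Lemma Ji_rank_mono x y : x < y -> (Ji_rank x < Ji_rank y)%N.
Proof.
move=> xy; rewrite ltnNge; apply/negP=> le_r.
have sub : [set p in Ji L | p <= x] \subset [set p in Ji L | p <= y].
  apply/subsetP=> p; rewrite !in_set => /andP[-> /le_trans]; apply.
  exact: ltW.
have /eqP e : [set p in Ji L | p <= x] == [set p in Ji L | p <= y].
  by rewrite eqEcard sub.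
suff : y <= x by rewrite (lt_geF xy).
apply: le_Ji => p pJ py.
have : p \in [set p in Ji L | p <= y] by rewrite in_set pJ.
by rewrite -e in_set pJ.
Qed.

Lemma Ji_rank_le x y : x <= y -> (Ji_rank x <= Ji_rank y)%N.
Proof. by rewrite le_eqVlt => /predU1P[->|/Ji_rank_mono/ltnW]. Qed.

Hypothesis dL : distributive L.

Lemma Ji_prime p x y : p \in Ji L -> (p <= x `|` y) = (p <= x) || (p <= y).
Proof.
move=> pJ; apply/idP/orP => [h|[] h].
- have e : p = (x `&` p) `|` (y `&` p).
    by rewrite -dL; apply/esym/meet_idPr.
  by have [->|->] := Ji_join pJ e; [left|right]; apply: leIl.
- exact: le_trans h (leUl _ _).
- exact: le_trans h (leUr _ _).
Qed.

Lemma Ji_prime_join (I : finType) (P : pred I) (F : I -> L) p :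
  p \in Ji L -> (p <= \join_(i | P i) F i) = [exists i, P i && (p <= F i)].
Proof.
move=> pJ; apply/idP/existsP => [|[i /andP[Pi pi]]]; last first.
  by apply: le_trans pi _; apply: joins_sup.
elim/big_rec: _ => [|i x Pi IH]; first by rewrite lex0 (negbTE (Ji_neq0 pJ)).
by rewrite Ji_prime // => /orP[pF|/IH//]; exists i; rewrite Pi.
Qed.

Lemma join_Ji x : \join_(p in Ji L | p <= x) p = x.
Proof.
apply/le_anti/andP; split; first by apply/joinsP => p /andP[].
by apply: le_Ji => p pJ px; apply: joins_sup; rewrite pJ.
Qed.

(** A join-irreducible below [y] but not below [x] joins with [x] to [y]. If [p] and [q] are two
    such elements, primeness puts each below the other. *)
Lemma Ji_rank_covers x y : covers x y -> Ji_rank y = (Ji_rank x).+1.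
Proof.
move=> [xy noz]; apply/eqP; rewrite eqn_leq Ji_rank_mono // andbT.
have joinE p : p <= y -> ~~ (p <= x) -> x `|` p = y.
  move=> py px; have := noz (x `|` p); rewrite negb_and.
  have xlt : x < x `|` p.
    rewrite lt_neqAle leUl andbT eq_sym.
    by apply: contra px => /eqP<-; apply: leUr.
  by rewrite xlt /= lt_neqAle leUx (ltW xy) py !andbT negbK => /eqP.
rewrite /Ji_rank -(cardsID [set p in Ji L | p <= x] [set p in Ji L | p <= y]).
rewrite -addn1 leq_add //; first by apply: subset_leq_card; apply: subsetIr.
apply/card_le1_eqP=> p q.
have diffE t : t \in [set p in Ji L | p <= y] :\: [set p in Ji L | p <= x] ->
    [/\ t \in Ji L, t <= y & ~~ (t <= x)].
  by rewrite in_setD !in_set => /andP[tx /andP[tJ ty]]; move: tx; rewrite tJ.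
move=> /diffE[pJ py px] /diffE[qJ qy qx].
apply/le_anti/andP; split.
  by have := qy; rewrite -(joinE p) // Ji_prime // (negbTE qx).
by have := py; rewrite -(joinE q) // Ji_prime // (negbTE px).
Qed.

(** Ranks strictly increase along a chain and stay between those of [x] and [y], which bounds its
    size. Descending from [y] by lower covers gives a chain that attains the bound. *)
Lemma poset_length_interval x y :
  x <= y -> poset_length (interval_set x y) = (Ji_rank y - Ji_rank x)%N.
Proof.
move=> xy; apply/eqP; rewrite eqn_leq; apply/andP; split.
  apply/bigmax_leqP=> C /andP[chC CI].
  have cmp u v : u \in C -> v \in C -> u >=< v.
    by move=> uC vC; move/forall_inP: chC => /(_ u uC)/forall_inP/(_ v vC).
  have uniq_ranks : uniq [seq Ji_rank u | u <- enum C].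
    rewrite map_inj_in_uniq ?enum_uniq // => u v; rewrite !mem_enum => uC vC e.
    apply/eqP; apply/negPn/negP=> ne; have := cmp u v uC vC.
    rewrite /Order.comparable !le_eqVlt (eq_sym v) (negbTE ne) /=.
    by case/orP=> /Ji_rank_mono; rewrite e ltnn.
  have : (size [seq Ji_rank u | u <- enum C] <=
          size (iota (Ji_rank x) (Ji_rank y - Ji_rank x).+1))%N.
    apply: uniq_leq_size => // n /mapP[u]; rewrite mem_enum => uC ->.
    have := subsetP CI u uC; rewrite inE => /andP[xu uy].
    by rewrite mem_iota Ji_rank_le //= addnS ltnS subnKC Ji_rank_le.
  by rewrite size_map -cardE size_iota; case: #|_|.
have [C [chC CI cC]] : exists C : {set L}, [/\ is_chain C,
    C \subset interval_set x y & #|C| = (Ji_rank y - Ji_rank x).+1].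
  elim/finposet_ind: y xy => y IH; rewrite le_eqVlt => /predU1P[<-|].
    exists [set x]; rewrite sub1set inE lexx cards1 subnn; split=> //.
    apply/forall_inP=> u /set1P->; apply/forall_inP=> v /set1P->.
    exact: comparablexx.
  move=> /lower_cover[c cy xc]; have [C [chC CI cC]] := IH c cy.1 xc.
  have leC u : u \in C -> u < y.
    move/(subsetP CI); rewrite inE => /andP[_ /le_lt_trans]; apply; exact: cy.1.
  have yC : y \notin C by apply/negP=> /leC; rewrite ltxx.
  exists (y |: C); split.
  - apply/forall_inP=> u; rewrite in_setU1 => /predU1P[->|uC].
      apply/forall_inP=> v; rewrite in_setU1 => /predU1P[->|/leC/ltW vy].
        exact: comparablexx.
      by rewrite /Order.comparable vy orbT.
    apply/forall_inP=> v; rewrite in_setU1 => /predU1P[->|vC].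
      by rewrite /Order.comparable (ltW (leC u uC)).
    by move/forall_inP: chC => /(_ u uC)/forall_inP/(_ v vC).
  - rewrite subUset sub1set inE lexx (le_trans xc (ltW cy.1)) /=.
    apply: subset_trans CI _; apply/subsetP=> u; rewrite !inE => /andP[-> /=].
    by move/le_trans; apply; apply: ltW; exact: cy.1.
  - by rewrite cardsU1 yC cC (Ji_rank_covers cy) subSn ?Ji_rank_le.
have -> : (Ji_rank y - Ji_rank x)%N = #|C|.-1 by rewrite cC.
by apply: (@leq_bigmax_cond _ _ (fun C : {set L} => #|C|.-1)); rewrite chC.
Qed.

End Ji.

(** * Modular lattices and complemented intervals *)

Lemma distributive_modular d (L : latticeType d) : distributive L -> modular L.
Proof.
move=> dL x y z xz; rewrite [RHS]dL.
by rewrite (meet_idPl xz).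
Qed.

Section Complemented.
Context {d : Order.disp_t} {L : finTBLatticeType d}.
Implicit Types a b s t u v w x y : L.
Hypothesis mL : modular L.

(** The two equations place [t] between [u] and [v], so the complement is taken inside the
    interval. *)
Definition complemented u v : bool :=
  [forall s, (u <= s <= v) ==> [exists t, (s `&` t == u) && (s `|` t == v)]].

Lemma complementedP u v :
  reflect (forall s, u <= s -> s <= v -> exists2 t, s `&` t = u & s `|` t = v)
          (complemented u v).
Proof.
apply: (iffP forallP) => [h s us sv|h s].
  have := h s; rewrite us sv => /existsP[t /andP[/eqP ? /eqP ?]].
  by exists t.
apply/implyP=> /andP[us sv]; have [t <- <-] := h s us sv.
by apply/existsP; exists t; rewrite !eqxx.
Qed.

Lemma complemented_sub u a b v :
  u <= a -> a <= b -> b <= v -> complemented u v -> complemented a b.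
Proof.
move=> ua ab bv /complementedP h; apply/complementedP=> s as_ sb.
have [t tm tj] := h s (le_trans ua as_) (le_trans sb bv).
exists ((a `|` t) `&` b).
  rewrite meetCA (meet_idPl sb) -(mL t as_) meetC tm.
  exact/join_idPl.
by rewrite mL // joinA (join_idPl as_) tj; apply/meet_idPr.
Qed.

(** By modularity [s] is the join of [w] and its meet with [v]; a complement of that meet, joined
    with [w], complements [s]. *)
Lemma complemented_joinr w u v : u <= v ->
  complemented u v -> complemented (u `|` w) (v `|` w).
Proof.
move=> uv /complementedP h; apply/complementedP=> s.
rewrite leUx => /andP[us ws] sv.
have sE : w `|` (v `&` s) = s by rewrite mL // joinC; apply/meet_idPr.
have [||t tm tj] := h (v `&` s); [by rewrite lexI uv|exact: leIl|].
have tv : t <= v by rewrite -tj leUr.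
exists (w `|` t).
  have -> : u = t `&` s by rewrite -tm meetAC (meet_idPr tv).
  by rewrite meetC -mL // joinC.
by rewrite -{1}sE joinACA joinxx tj joinC.
Qed.

(** The complement is built in two stages: [c] complements the part of [s] below [a], then [e]
    complements the part below [b] of the join of [s] and [c]. The join of [c] and [e] complements
    [s]. *)
Lemma complemented_join2 w a b : w <= a -> w <= b ->
  complemented w a -> complemented w b -> complemented w (a `|` b).
Proof.
move=> wa wb /complementedP ha /complementedP hb; apply/complementedP=> s ws sab.
have [||c cm cj] := ha (s `&` a); [by rewrite lexI ws|exact: leIr|].
have ca : c <= a by rewrite -cj leUr.
have wc : w <= c by rewrite -cm leIr.
have [||e em ej] := hb ((s `|` c) `&` b).
- by rewrite lexI wb (le_trans ws (leUl _ _)).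
- exact: leIr.
have eb : e <= b by rewrite -ej leUr.
have scm : s `&` c = w by rewrite -cm -meetA (meet_idPr ca).
have sem : (s `|` c) `&` e = w by rewrite -em -meetA (meet_idPr eb).
have a_le : a <= s `|` c by rewrite -cj leU2 // leIl.
exists (c `|` e).
  rewrite -{1}(meet_idPl (leUl s c)) -meetA [(s `|` c) `&` _]meetC -mL ?leUr //.
  by rewrite [e `&` _]meetC sem (join_idPl wc).
apply/le_anti.
rewrite !leUx sab (le_trans ca (leUl _ _)) (le_trans eb (leUr _ _)).
rewrite joinA (le_trans a_le (leUl _ _)) /= -{1}ej leUx leUr andbT.
exact: le_trans (leIl _ _) (leUl _ _).
Qed.

(** Both intervals are first shifted up to a common lower end, the join of [u] and [u']. *)
Lemma complementedU u v u' v' : u <= v -> u' <= v' ->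
  complemented u v -> complemented u' v' -> complemented (u `|` u') (v `|` v').
Proof.
move=> uv uv' h h'.
have -> : v `|` v' = (v `|` u') `|` (v' `|` u).
  by rewrite joinACA [u' `|` u]joinC joinACA (join_idPl uv) (join_idPl uv').
apply: complemented_join2; rewrite ?leUx ?leUr ?andbT //=.
- exact: le_trans uv (leUl _ _).
- exact: le_trans uv' (leUl _ _).
- exact: complemented_joinr.
- by rewrite joinC; apply: complemented_joinr.
Qed.

End Complemented.

Lemma complemented_dual d (L : finTBLatticeType d) (u v : L) :
  @complemented _ L^d v u = complemented u v.
Proof.
apply/complementedP/complementedP => h s us sv.
  by have [t tm tj] := h s sv us; exists t.
by have [t tm tj] := h s sv us; exists t.
Qed.

Lemma modular_dual d (L : latticeType d) : modular L -> modular L^d.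
Proof.
move=> mL x y z zx.
suff: (x : L) `&` ((y : L) `|` (z : L)) =
      ((x : L) `&` (y : L)) `|` (z : L) by [].
by rewrite meetC joinC -mL // joinC meetC.
Qed.

Lemma complementedI d (L : finTBLatticeType d) (u v u' v' : L) :
  modular L -> u <= v -> u' <= v' ->
  complemented u v -> complemented u' v' -> complemented (u `&` u') (v `&` v').
Proof.
move=> /modular_dual mL uv uv' h h'; rewrite -(complemented_dual (u `&` u')).
apply: (@complementedU _ L^d mL v u v' u') => //.
  by rewrite (complemented_dual u v).
by rewrite (complemented_dual u' v').
Qed.

(** * The skeleton tolerance of a modular lattice *)

Section ModularSkeleton.
Context {d : Order.disp_t} {L : finTBLatticeType d}.
Implicit Types x y p r : L.
Hypothesis mL : modular L.

Definition complemented_tolset : {set L * L} :=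
  [set xy | complemented (xy.1 `&` xy.2) (xy.1 `|` xy.2)].

Lemma complemented_tolset_tolerance : is_tolerance complemented_tolset.
Proof.
have leIU x y : x `&` y <= x `|` y by apply: le_trans (leIl _ _) (leUl _ _).
apply/is_toleranceP; split=> [x|x y|x y z t|x y z t].
- rewrite inE /= meetxx joinxx; apply/complementedP=> s xs sx.
  by exists x; [apply/meet_idPr | apply/join_idPr].
- by rewrite !inE /= meetC joinC.
- rewrite !inE /= => /(complementedU mL (leIU _ _) (leIU _ _)) h /h.
  rewrite joinACA; apply: complemented_sub => //.
  by rewrite lexI !leU2 ?leIl ?leIr.
- rewrite !inE /= => /(complementedI mL (leIU _ _) (leIU _ _)) h /h.
  rewrite meetACA; apply: complemented_sub => //.
  by rewrite leUx !leI2 ?leUl ?leUr.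
Qed.

Lemma complemented_tolset_glued : glued complemented_tolset.
Proof.
apply: covers_glued complemented_tolset_tolerance _ => x y [xy noz].
rewrite inE /= (meet_idPl (ltW xy)) (join_idPr (ltW xy)).
apply/complementedP=> s; rewrite !le_eqVlt => /predU1P[<- _|xs].
  by exists y; [apply/meet_idPl | apply/join_idPr]; apply: ltW.
case/predU1P=> [->|sy]; last by have := noz s; rewrite xs sy.
by exists x; [apply/meet_idPr | apply/join_idPl]; apply: ltW.
Qed.

Local Notation T := (@skeleton_tol d L).

Lemma skeleton_lb_lt r : r != \bot -> tol_lb T r < r.
Proof.
rewrite -lt0x => /lower_cover[c cr _]; apply: le_lt_trans cr.1.
apply/tol_lbP/tol_sym/(glued_covers _ _ cr); first exact: tolerance_subproof.
by case: (@skeleton_tol_smallest _ L).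
Qed.

(** Let [t] complement the join of [p] and [tol_lb T r] between [tol_lb T r] and [r]. As [r] is
    join-irreducible and strictly above both [p] and [tol_lb T r], it equals [t]; the meet equation
    then puts [p] below [tol_lb T r]. *)
Lemma Ji_lt_lb p r : r \in Ji L -> p < r -> p <= tol_lb T r.
Proof.
move=> rJ pr; have lr := skeleton_lb_lt (Ji_neq0 rJ).
have : (tol_lb T r, r) \in complemented_tolset.
  have [_ /(_ _ complemented_tolset_tolerance complemented_tolset_glued)] :=
    @skeleton_tol_smallest _ L.
  by move/subsetP; apply; apply/tol_sym/tol_lbT.
rewrite inE /= (meet_idPl (ltW lr)) (join_idPr (ltW lr)) => /complementedP.
move=> /(_ (p `|` tol_lb T r)) []; first exact: leUr.
  by rewrite leUx !ltW.
move=> t tm /esym/(Ji_join rJ)[re|re].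
  case: (Ji_join rJ re) => e; first by rewrite -e ltxx in pr.
  by rewrite -e ltxx in lr.
move: tm; rewrite -re => <-; rewrite lexI leUl; exact: ltW.
Qed.

End ModularSkeleton.

(** * Intersecting blocks *)

Section Overlap.
Context {d : Order.disp_t} {L : finTBLatticeType d} (T : tolerance L).
Implicit Types alpha beta : factor T.

Lemma factor_leE alpha beta : (alpha <= beta) = (zero_of alpha <= zero_of beta).
Proof. by []. Qed.

Lemma factor_le_one alpha beta :
  (alpha <= beta) = (one_of alpha <= one_of beta).
Proof. by rewrite one_le. Qed.

Lemma zero_of0 : zero_of (\bot : factor T) = \bot.
Proof.
apply/eqP; rewrite -lex0.
by have [gamma e] := exists_zero T \bot; have := le0x gamma;
  rewrite factor_leE e => /le_trans; apply; apply: tol_lb_le.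
Qed.

Lemma one_of1 : one_of (\top : factor T) = \top.
Proof.
apply/eqP; rewrite -le1x.
by have [gamma e] := exists_one T \top; have := lex1 gamma;
  rewrite factor_le_one e; apply: le_trans; apply: tol_ub_le.
Qed.

Lemma zero_ofU alpha beta :
  zero_of (alpha `|` beta) = zero_of alpha `|` zero_of beta.
Proof. exact: zero_join. Qed.

Lemma one_ofI alpha beta :
  one_of (alpha `&` beta) = one_of alpha `&` one_of beta.
Proof. exact: one_meet. Qed.

(** The Galois connection between [tol_lb] and [tol_ub], read at the zero of a block. *)
Lemma tol_lb_galois x alpha :
  (tol_lb T x <= zero_of alpha) = (x <= one_of alpha).
Proof.
apply/idP/idP => h.
  rewrite oneE; apply: le_trans (tol_ub_mono T h).
  exact/tol_ubP/tol_sym/tol_lbT.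
by rewrite zeroE tol_lb_mono.
Qed.

(* As blocks are intervals, this relates two blocks when they intersect. *)
Definition overlap_tolset : {set factor T * factor T} :=
  [set ab | (zero_of ab.1 <= one_of ab.2) && (zero_of ab.2 <= one_of ab.1)].

Lemma overlap_tolerance : is_tolerance overlap_tolset.
Proof.
have zU (a b c e : factor T) : zero_of a <= one_of c -> zero_of b <= one_of e ->
    zero_of (a `|` b) <= one_of (c `|` e).
  move=> ac be; rewrite zero_ofU leUx (le_trans ac) ?(le_trans be) //;
    by rewrite -factor_le_one ?leUl ?leUr.
have oI (a b c e : factor T) : zero_of a <= one_of c -> zero_of b <= one_of e ->
    zero_of (a `&` b) <= one_of (c `&` e).
  move=> ac be; rewrite one_ofI lexI (le_trans _ ac) ?(le_trans _ be) //;
    by rewrite -factor_leE ?leIl ?leIr.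
apply/is_toleranceP; split=> [a|a b|a b c e|a b c e].
- by rewrite inE /= zero_le_one.
- by rewrite !inE /= andbC.
- by rewrite !inE /= => /andP[h1 h2] /andP[h3 h4]; rewrite !zU.
- by rewrite !inE /= => /andP[h1 h2] /andP[h3 h4]; rewrite !oI.
Qed.

(** For [a] covered by [b], take a lower cover [c] of the zero of [b] that lies above the zero of
    [a]. The block with unit [tol_ub T c] lies between [a] and [b] and differs from [b], so it is
    [a]; its unit is above the zero of [b] because [T] relates [c] to that zero. *)
Lemma overlap_glued : glued T -> glued overlap_tolset.
Proof.
move=> gT; apply: covers_glued overlap_tolerance _ => a b [ab noz].
rewrite inE /= (le_trans (zero_le_one a)) -?factor_le_one ?(ltW ab) //=.
have : zero_of a < zero_of b.
  by rewrite lt_neqAle (inj_eq (@zero_inj _ _ _)) (lt_eqF ab) -factor_leE ltW.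
move=> /lower_cover[c cb ac]; have [g ge] := exists_one T c.
have ag : a <= g by rewrite factor_le_one ge oneE tol_ub_mono.
have gb : g < b.
  rewrite lt_neqAle factor_le_one ge oneE tol_ub_mono ?(ltW cb.1) // andbT.
  apply/eqP=> gb; have : zero_of b <= c; last by rewrite (lt_geF cb.1).
  by rewrite -gb zeroE ge; apply/tol_lbP/tol_sym/tol_ubT.
have -> : a = g.
  apply/eqP; have := noz g; rewrite gb andbT lt_neqAle ag andbT negbK.
  by rewrite eq_sym.
by rewrite ge; apply/tol_ubP/(glued_covers (tolerance_subproof T) gT cb).
Qed.

End Overlap.

Lemma H_irreducible2_overlap d (L : finTBLatticeType d) : H_irreducible 2 L ->
  zero_of (\top : skeleton L) <= one_of (\bot : skeleton L).
Proof.
rewrite /H_irreducible /iter_skeleton /=; set K := skeleton L => cK.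
have K1 (a b : skeleton K) : a = b.
  have /card_le1_eqP : (#|skeleton K| <= 1)%N by rewrite cK.
  by move=> h; apply: h; rewrite inE.
have [a ea] := exists_zero (@skeleton_tol _ K) \bot.
have [b eb] := exists_one (@skeleton_tol _ K) \top.
have za : zero_of a = \bot by apply/eqP; rewrite -lex0 ea tol_lb_le.
have ob : one_of b = \top by apply/eqP; rewrite -le1x eb tol_ub_le.
have := tol_zero_one a; rewrite za (K1 a b) ob => /(subsetP _).
have [gK _] := @skeleton_tol_smallest _ L.
have [_ /(_ _ (overlap_tolerance _) (overlap_glued gK)) sub] :=
  @skeleton_tol_smallest _ K.
by move=> /(_ _ sub); rewrite inE => /andP[_].
Qed.

(** * Join-irreducibles seen from the skeleton *)

Section DoubleSkeleton.
Context {d : Order.disp_t} {L : finTBLatticeType d}.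
Local Notation T := (@skeleton_tol d L).
Local Notation S := (skeleton L).
Implicit Types (x y p q r : L) (alpha beta : S).

(** If [p < q < r], then [q] lies below [tol_lb T r], hence below the zero of the top block and the
    unit of the bottom block. So [tol_lb T q] is the bottom of [L], yet [p] lies below it. *)
Lemma overlap_length_Ji :
  modular L -> zero_of (\top : S) <= one_of (\bot : S) ->
  (poset_length (Ji L) <= 1)%N.
Proof.
move=> mL ov; apply/length_Ji_le1P => p q r pJ qJ rJ pq.
apply/negP=> /(Ji_lt_lb mL rJ) qr.
have : tol_lb T q <= zero_of (\bot : S).
  rewrite tol_lb_galois; apply: le_trans ov; apply: le_trans qr _.
  by rewrite tol_lb_galois one_of1 lex1.
rewrite zero_of0 => /(le_trans (Ji_lt_lb mL qJ pq)).
by rewrite lex0 (negbTE (Ji_neq0 pJ)).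
Qed.

Hypothesis dL : distributive L.
Let mL := distributive_modular dL.

(** As [tol_lb] preserves joins and [p] is join-prime, [p] lies below [tol_lb T q] for some
    join-irreducible [q] below [x], and [tol_lb T q < q]. *)
Lemma Ji_le_lb p x : p \in Ji L -> p <= tol_lb T x ->
  exists q, [/\ q \in Ji L, q <= x & p < q].
Proof.
move=> pJ; rewrite -{1}(join_Ji x).
have lb0 : tol_lb T \bot = \bot by apply/eqP; rewrite -lex0 tol_lb_le.
rewrite (big_morph _ (tol_lbU T) lb0) Ji_prime_join //.
case/existsP=> q /andP[/andP[qJ qx] pq]; exists q; split=> //.
exact: le_lt_trans pq (skeleton_lb_lt (Ji_neq0 qJ)).
Qed.

(** Overlap says that applying [tol_lb] twice to the top gives the bottom; a join-irreducible below
    that value would start a three-element chain. *)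
Lemma length_Ji_overlap : (poset_length (Ji L) <= 1)%N ->
  zero_of (\top : S) <= one_of (\bot : S).
Proof.
move=> /length_Ji_le1P no3; rewrite -tol_lb_galois zero_of0 zeroE one_of1.
apply: le_Ji => p pJ /(Ji_le_lb pJ)[q [qJ q_le pq]].
have [r [rJ _ qr]] := Ji_le_lb qJ q_le.
by have := no3 p q r pJ qJ rJ pq; rewrite qr.
Qed.

(** This is the block [N p]; [Ji_avoid] is [k p]. *)
Definition Ji_block p : S := sval (exists_zero T p).

(* The zeros of blocks are closed under joins and [p] is join-prime, so this
   join is itself a block whose zero is not above [p]. *)
Definition Ji_avoid p : S := \join_(alpha : S | ~~ (p <= zero_of alpha)) alpha.

Lemma Ji_block_le p alpha : (Ji_block p <= alpha) = (p <= one_of alpha).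
Proof.
rewrite factor_leE /Ji_block; case: exists_zero => b /= ->.
exact: tol_lb_galois.
Qed.

Lemma le_Ji_avoid p alpha : p \in Ji L ->
  (alpha <= Ji_avoid p) = ~~ (p <= zero_of alpha).
Proof.
move=> pJ; apply/idP/idP => [|h]; last exact: joins_sup.
rewrite factor_leE => le_z; apply/negP => /le_trans/(_ le_z).
apply/negP; rewrite /Ji_avoid; elim/big_ind: _ => // [|a b ha hb].
  by rewrite zero_of0 lex0 Ji_neq0.
by rewrite zero_ofU Ji_prime // negb_or ha.
Qed.

(** For distinct elements, [p <= q] means [p <= tol_lb T q], and [tol_lb T q] is the zero of
    [Ji_block q]. *)
Lemma Ji_leE p q : p \in Ji L -> q \in Ji L ->
  (p <= q) = (p == q) || ~~ (Ji_block q <= Ji_avoid p).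
Proof.
move=> pJ qJ; rewrite le_Ji_avoid // negbK /Ji_block.
case: exists_zero => b /= ->.
rewrite le_eqVlt; have [//|_] := eqVneq p q.
apply/idP/idP => /= [|h]; first exact: Ji_lt_lb.
exact: le_lt_trans h (skeleton_lb_lt (Ji_neq0 qJ)).
Qed.

(** The set is a difference of two down-sets of join-irreducibles. Overlap puts every zero below
    every unit, so one down-set contains the other and the subtraction is not truncated. *)
Lemma card_Ji_block_avoid alpha beta :
  zero_of (\top : S) <= one_of (\bot : S) ->
  #|[set p in Ji L | (Ji_block p <= alpha) && (beta <= Ji_avoid p)]| =
  (Ji_rank (one_of alpha) - Ji_rank (zero_of beta))%N.
Proof.
move=> ov; have le_ba : zero_of beta <= one_of alpha.
  apply: (@le_trans _ _ (zero_of (\top : S))).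
    by rewrite -factor_leE lex1.
  by apply: le_trans ov _; rewrite -factor_le_one le0x.
pose D x := [set p in Ji L | p <= x].
have sub : D (zero_of beta) \subset D (one_of alpha).
  apply/subsetP=> p; rewrite !in_set => /andP[-> /le_trans]; exact.
rewrite /Ji_rank -/(D _) -/(D (zero_of beta)) -(setIidPr sub) -cardsD.
have inJ (P : pred L) p : (p \in [set p in Ji L | P p]) = (p \in Ji L) && P p.
  by rewrite in_set.
congr #|pred_of_set _|; apply/setP=> p; rewrite in_setD !inJ.
have [pJ|pJ] /= := boolP (p \in Ji L); last by [].
by rewrite Ji_block_le le_Ji_avoid // andbC.
Qed.

Lemma Ji_rank0 : Ji_rank (\bot : L) = 0%N.
Proof.
apply/eqP; rewrite cards_eq0 -subset0; apply/subsetP=> p.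
by rewrite in_set => /andP[pJ]; rewrite lex0 (negbTE (Ji_neq0 pJ)).
Qed.

End DoubleSkeleton.

(* Moebius inversion over [I]. *)
Lemma card_fiber_downset d (I : finPOrderType d) (T T' : finType)
    (A : {set T}) (A' : {set T'}) (k : T -> I) (k' : T' -> I) :
  (forall i, #|[set a in A | k a <= i]| = #|[set a in A' | k' a <= i]|) ->
  forall i, #|[set a in A | k a == i]| = #|[set a in A' | k' a == i]|.
Proof.
move=> eq_down.
have downE (U : finType) (B : {set U}) (h : U -> I) i :
    #|[set a in B | h a <= i]| = \sum_(j | j <= i) #|[set a in B | h a == j]|.
  rewrite -sum1_card (partition_big h (fun j => j <= i)) => [|a]; last first.
    by rewrite inE => /andP[].
  apply: eq_bigr => j ji; rewrite -sum1_card; apply: eq_bigl => a.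
  by rewrite !inE -andbA; case: eqP => [->|]; rewrite ?ji ?andbF.
elim/finposet_ind=> i IH; have := eq_down i.
(* By induction the terms with [j < i] agree on both sides and cancel. *)
rewrite !downE (bigD1 i) //= [in RHS](bigD1 i) //=.
rewrite (eq_bigr (fun j => #|[set a in A' | k' a == j]|)) => [/addIn //|j].
by move=> /andP[ji ne]; apply: IH; rewrite lt_neqAle ne.
Qed.

(** * Matching equinumerous fibres *)

Section Transfer.
Variables (I : eqType) (T T' : finType) (A : {set T}) (A' : {set T'}).
Variables (k : T -> I) (k' : T' -> I) (x0 : T').

(** The n-th element of a fibre goes to the n-th element of the matching fibre. When matching fibres
    have equal size, the default [x0] is never reached for [a] in [A]. *)
Definition fiber_transfer a : T' :=
  nth x0 (enum [set b in A' | k' b == k a])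
         (index a (enum [set b in A | k b == k a])).

Hypothesis eq_card :
  forall i, #|[set a in A | k a == i]| = #|[set a in A' | k' a == i]|.

Lemma fiber_transfer_lt a : a \in A ->
  (index a (enum [set b in A | k b == k a]) <
   size (enum [set b in A' | k' b == k a]))%N.
Proof.
by move=> aA; rewrite -cardE -eq_card cardE index_mem mem_enum inE aA eqxx.
Qed.

Lemma fiber_transferP a : a \in A ->
  fiber_transfer a \in A' /\ k' (fiber_transfer a) = k a.
Proof.
move=> /fiber_transfer_lt/(mem_nth x0); rewrite mem_enum inE.
by case/andP=> ? /eqP ?.
Qed.
End Transfer.

Lemma fiber_transferK (I : eqType) (T T' : finType) (A : {set T})
    (A' : {set T'}) (k : T -> I) (k' : T' -> I) (x0 : T) (x0' : T') :
  (forall i, #|[set a in A | k a == i]| = #|[set a in A' | k' a == i]|) ->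
  {in A, cancel (fiber_transfer A A' k k' x0') (fiber_transfer A' A k' k x0)}.
Proof.
move=> eq_card a aA; rewrite {1}/fiber_transfer.
have [_ ->] := fiber_transferP x0' eq_card aA.
rewrite index_uniq ?enum_uniq ?fiber_transfer_lt //.
by apply: nth_index; rewrite mem_enum inE aA eqxx.
Qed.

(** * Extending maps of join-irreducibles to lattices *)

Section JiIsomorphism.
Context {d d' : Order.disp_t} {L : finTBLatticeType d}.
Context {L' : finTBLatticeType d'}.

Definition Ji_extension (f : L -> L') x := \join_(p in Ji L | p <= x) f p.

(** The join-irreducibles below an image are read off through [g], so identities for the extension
    can be checked on join-irreducibles, as in Birkhoff duality. *)
Lemma le_Ji_extension (f : L -> L') (g : L' -> L) x q : distributive L' ->
  {in Ji L', forall q, g q \in Ji L} ->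
  {in Ji L, cancel f g} -> {in Ji L', cancel g f} ->
  {in Ji L &, {mono f : p q / p <= q}} ->
  q \in Ji L' -> (q <= Ji_extension f x) = (g q <= x).
Proof.
move=> dL' gJ fK gK fM qJ; rewrite Ji_prime_join //.
apply/existsP/idP => [[p /andP[/andP[pJ px]]]|gx].
  by rewrite -{1}(gK q qJ) fM ?gJ // => /le_trans; apply.
by exists (g q); rewrite gJ // gx gK /=.
Qed.

End JiIsomorphism.

Lemma lattice_isomorphic_Ji d d' (L : finTBLatticeType d)
    (L' : finTBLatticeType d') (f : L -> L') (g : L' -> L) : distributive L -> distributive L' ->
  {in Ji L, forall p, f p \in Ji L'} -> {in Ji L', forall q, g q \in Ji L} ->
  {in Ji L, cancel f g} -> {in Ji L', cancel g f} ->
  {in Ji L &, {mono f : p q / p <= q}} ->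
  lattice_isomorphic L L'.
Proof.
move=> dL dL' fJ gJ fK gK fM.
have gM : {in Ji L' &, {mono g : p q / p <= q}}.
  by move=> p q pJ qJ; rewrite -fM ?gJ // !gK.
have FE x := le_Ji_extension x dL' gJ fK gK fM.
have GE x := le_Ji_extension x dL fJ gK fK gM.
exists (Ji_extension f); split.
- exists (Ji_extension g) => x; apply: eq_Ji => p pJ.
    by rewrite GE // FE ?fJ // fK.
  by rewrite FE // GE ?gJ // gK.
- by move=> x y; apply: eq_Ji => p pJ; rewrite lexI !FE // lexI.
- move=> x y; apply: eq_Ji => p pJ.
  by rewrite Ji_prime // !FE // Ji_prime // gJ.
Qed.

(** * Reconstruction from the weighted double skeleton *)

Lemma lattice_iso_mono d d' (L : latticeType d) (L' : latticeType d')
    (f : L -> L') :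
  is_lattice_iso f -> {mono f : x y / x <= y}.
Proof.
by move=> [/bij_inj fI fm _] x y; rewrite !leEmeet -fm (inj_eq fI).
Qed.

Lemma bij_mono_bounds d d' (P : tbLatticeType d) (P' : tbLatticeType d')
    (f : P -> P') :
  bijective f -> {mono f : x y / x <= y} -> f \bot = \bot /\ f \top = \top.
Proof.
move=> [g fK gK] fM; split; apply/le_anti; rewrite ?le0x ?lex1 ?andbT /=.
  by rewrite -[X in _ <= X]gK fM le0x.
by rewrite -[X in X <= _]gK fM lex1.
Qed.

(** Weights of covers in the poset of ends are rank differences, so ranks agree by induction upwards
    from the value 0 at the bottom. *)
Lemma wd_isomorphic_Ji_rank d d' (L : finTBLatticeType d)
    (L' : finTBLatticeType d') (psi : skeleton_end L -> skeleton_end L')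
    (bot : skeleton_end L) :
  distributive L -> distributive L' ->
  {mono psi : x y / x <= y} -> (bot : L) = \bot -> (psi bot : L') = \bot ->
  (forall x y : skeleton_end L, covers x y ->
    poset_length (interval_set (x : L) (y : L)) =
    poset_length (interval_set (psi x : L') (psi y : L'))) ->
  forall x, Ji_rank (psi x : L') = Ji_rank (x : L).
Proof.
move=> dL dL' psiM bot0 pbot0 wE; elim/finposet_ind=> x IH.
have lebx : bot <= x by have := le0x (x : L); rewrite -bot0.
move: lebx; rewrite le_eqVlt => /predU1P[<-|/lower_cover[c cx _]].
  by rewrite bot0 pbot0 !Ji_rank0.
have ltcx := cx.1.
have lecx : skeleton_end_val c <= skeleton_end_val x by apply: (ltW ltcx).
have lepp : skeleton_end_val (psi c) <= skeleton_end_val (psi x).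
  by have := psiM c x; rewrite (ltW ltcx).
have := wE _ _ cx; rewrite !poset_length_interval // -(IH _ ltcx).
have := Ji_rank_le lecx; have := Ji_rank_le lepp; rewrite -(IH _ ltcx) => h1 h2.
(* Adding back the rank of [psi c], which is at most both minuends, undoes the truncated
   subtractions. *)
move=> /(congr1 (addn^~ (Ji_rank (skeleton_end_val (psi c))))).
by rewrite !subnK.
Qed.

Lemma wd_isomorphic_determined d d' (L : finTBLatticeType d)
    (L' : finTBLatticeType d') :
  distributive L -> distributive L' ->
  zero_of (\top : skeleton L') <= one_of (\bot : skeleton L') ->
  wd_isomorphic (weighted_double_skeleton L) (weighted_double_skeleton L') ->
  lattice_isomorphic L L'.
Proof.
move=> dL dL' ov' [psi [kappa [[psib psiM] kiso eta0 eta1 wE]]].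
rewrite /= in psi kappa psib psiM kiso eta0 eta1 wE.
have kM := lattice_iso_mono kiso; have [kb _ _] := kiso.
have [k0 k1] := bij_mono_bounds kb kM.
have psi0 a : zero_of (kappa a) = psi (SkeletonEnd (eta0_subproof a)) :> L'.
  by rewrite eta0.
have psi1 a : one_of (kappa a) = psi (SkeletonEnd (eta1_subproof a)) :> L'.
  by rewrite eta1.
(* Overlap compares two ends, so it is carried back along [psi]. *)
have ov : zero_of (\top : skeleton L) <= one_of (\bot : skeleton L).
  rewrite -k0 -k1 psi0 psi1 in ov'.
  by have := psiM (SkeletonEnd (eta0_subproof (\top : skeleton L)))
                  (SkeletonEnd (eta1_subproof (\bot : skeleton L)));
    rewrite [LHS]ov'.
have rk : forall x, Ji_rank (psi x : L') = Ji_rank (x : L).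
  pose bot := SkeletonEnd (eta0_subproof (\bot : skeleton L)).
  apply: (wd_isomorphic_Ji_rank (bot := bot)) => //.
    exact: zero_of0.
  by rewrite -psi0 k0 zero_of0.
pose K := skeleton L'.
(* The second component lives in the dual order, so that the elements with key below a given pair
   are those counted by [card_Ji_block_avoid]. Applying [kappa] puts the keys of both lattices in
   one poset. *)
pose key (p : L) : K *p K^d := (kappa (Ji_block p), kappa (Ji_avoid p)).
pose key' (p : L') : K *p K^d := (Ji_block p, Ji_avoid p).
have fib : forall i,
    #|[set p in Ji L | key p == i]| = #|[set p in Ji L' | key' p == i]|.
  apply: card_fiber_downset => -[a b]; have [h hK kK] := kb.
  rewrite -(kK a) -(kK b).
  have -> : [set p in Ji L' | key' p <= (kappa (h a), kappa (h b) : K^d)] =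
      [set p in Ji L' |
        (Ji_block p <= kappa (h a)) && (kappa (h b) <= Ji_avoid p)] by [].
  have -> : [set p in Ji L | key p <= (kappa (h a), kappa (h b) : K^d)] =
     [set p in Ji L | (Ji_block p <= h a) && (h b <= Ji_avoid p)].
    apply/setP=> p; rewrite !in_set.
    by rewrite -[X in _ && X = _]/(_ && (kappa _ <= kappa _)) !kM.
  by rewrite !card_Ji_block_avoid // psi0 psi1 !rk.
pose f := fiber_transfer (Ji L) (Ji L') key key' \bot.
pose g := fiber_transfer (Ji L') (Ji L) key' key \bot.
have fP := fiber_transferP \bot fib.
have gP := fiber_transferP \bot (fun i => esym (fib i)).
have fK : {in Ji L, cancel f g} := fiber_transferK _ _ fib.
have gK : {in Ji L', cancel g f} := fiber_transferK _ _ (fun i => esym (fib i)).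
apply: (@lattice_isomorphic_Ji _ _ L L' f g) => //.
- by move=> p /fP[].
- by move=> p /gP[].
(* The order on join-irreducibles depends only on equality and on keys; [f] is injective and
   preserves keys. *)
move=> p q pJ qJ; have [fpJ fpE] := fP p pJ; have [fqJ fqE] := fP q qJ.
rewrite (Ji_leE dL pJ qJ) (Ji_leE dL' fpJ fqJ) (inj_in_eq (can_in_inj fK)) //.
by case: fpE fqE => _ -> [-> _]; rewrite kM.
Qed.

Theorem theorem1p1 (d : Order.disp_t) (L : finTBLatticeType d) :
  (2 <= #|L|)%N ->
  [/\ modular L -> H_irreducible 2 L -> (poset_length (Ji L) <= 1)%N,
      distributive L -> H_irreducible 2 L ->
        forall (d' : Order.disp_t) (L' : finTBLatticeType d'),
          distributive L' ->
          wd_isomorphic (weighted_double_skeleton L')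
                        (weighted_double_skeleton L) ->
          lattice_isomorphic L' L &
      distributive L -> (poset_length (Ji L) <= 1)%N ->
        forall (d' : Order.disp_t) (L' : finTBLatticeType d'),
          distributive L' -> (poset_length (Ji L') <= 1)%N ->
          wd_isomorphic (weighted_double_skeleton L')
                        (weighted_double_skeleton L) ->
          lattice_isomorphic L' L].
Proof.
move=> _; split.
- by move=> mL /H_irreducible2_overlap; apply: overlap_length_Ji.
- move=> dL /H_irreducible2_overlap ov d' L' dL'.
  exact: wd_isomorphic_determined.
- move=> dL /(length_Ji_overlap dL) ov d' L' dL' _.
  exact: wd_isomorphic_determined.
Qed.
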